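(* Let $X$ be a set and let $(f_i)_{i\in I}$ be a family of maps $f_i:X\to X$ that is non-overlapping, and such that for each $i\in I$ and each $y\in X$ the fibre $f_i^{-1}(y)$ is finite. For $A\subseteq X$ let $F_{\mathcal S}(A):=\bigcup_{i\in I}f_i(A)$. Then for each $A\subseteq X$ such that $F_{\mathcal S}(A)\subseteq A$, the set $\bigcap_{n\in\mathbb N}F_{\mathcal S}^n(A)$ is a fixed point of $F_{\mathcal S}$. In particular, $\bigcap_{n\in\mathbb N}F_{\mathcal S}^n(X)$ is the greatest fixed point of $F_{\mathcal S}$ (with respect to inclusion). Consequently, $F_{\mathcal S}$ admits a nonempty fixed point if and only if $\bigcap_{n\in\mathbb N}F_{\mathcal S}^n(X)\neq\varnothing$.
   Context: The index set $I$ is arbitrary (possibly infinite). The family $(f_i)_{i\in I}$ of selfmaps of $X$ is called non-overlapping if $f_i(B)\cap f_j(B)=\varnothing$ for all $B\subseteq X$ and all $i,j\in I$ with $i\ne j$ (equivalently, $f_i(X)\cap f_j(X)=\varnothing$ for all $i\neq j$). The operator $F_{\mathcal S}$ is regarded as a map from the family of all subsets of $X$ to itself; $F_{\mathcal S}^n$ is its $n$-fold composition, and a fixed point of $F_{\mathcal S}$ is a subset $A\subseteq X$ with $F_{\mathcal S}(A)=A$. *)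

(* Defs.v *)
From mathcomp Require Import all_boot.
From mathcomp Require Import boolp classical_sets functions cardinality.

Set Implicit Arguments.
Unset Strict Implicit.
Unset Printing Implicit Defensive.

Local Open Scope classical_set_scope.

Section SelfmapFamily.
Variables (X I : Type) (f : I -> X -> X).

Definition non_overlapping : Prop :=
  forall (B : set X) (i j : I), i <> j -> f i @` B `&` f j @` B = set0.

Definition finite_fibres : Prop :=
  forall (i : I) (y : X), finite_set (f i @^-1` [set y]).

Definition hutchinson (A : set X) : set X := \bigcup_i (f i @` A).

(* The index n starts at 0, where the iterate is A itself; when
   hutchinson A `<=` A (in particular when A = setT) starting at 1 gives the
   same set. *)
Definition iterates_cap (A : set X) : set X := \bigcap_n iter n hutchinson A.

End SelfmapFamily.

Definition fixed_set (X : Type) (F : set X -> set X) (A : set X) : Prop :=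
  F A = A.

Definition greatest_fixed_set (X : Type) (F : set X -> set X) (A : set X)
  : Prop :=
  fixed_set F A /\ forall B : set X, fixed_set F B -> B `<=` A.

(* Main.v *)
Require Import Defs.
From mathcomp Require Import all_boot.
From mathcomp Require Import boolp classical_sets functions cardinality.

(** Write F for the operator [hutchinson f] and let F A be contained in A.  The
iterates F^n A then decrease, so by monotonicity F maps their intersection C
into itself.  The content is the converse inclusion: a point y of C has, for
every n, a preimage in F^n A under some map of the family, and a single pair
(i, x) must be found that works for all n.  The two hypotheses settle the two
coordinates.  Since the maps are non-overlapping, y lies in the range of only
one of them, which fixes i ([non_overlapping_index_unique]).  The fibre of that
f i over y is finite, and it meets every term of the decreasing sequence F^n A,
so some point x of it lies in all of them
([finite_set_meets_nonincreasing_cap]); this is compactness of a finite set.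

The remaining claims are formal: a fixed point is equal to its own iterates,
hence contained in every F^n X. *)

Local Open Scope classical_set_scope.

(** If each point x of D left the sequence at some stage N x, then finiteness of
D would bound these stages, and D would miss S at the bound. *)
Lemma finite_set_meets_nonincreasing_cap (T : Type) (D : set T)
    (S : nat -> set T) :
  finite_set D -> (forall m n, m <= n -> S n `<=` S m) ->
  (forall n, D `&` S n !=set0) -> D `&` \bigcap_n S n !=set0.
Proof.
move=> finD S_anti DS; apply: contrapT => noDS.
have leaves x : exists n, D x -> ~ S n x.
  have [Dx|] := pselect (D x); last by exists 0.
  apply: contrapT => stays; apply: noDS; exists x; split=> // n _.
  by apply: contrapT => nSx; apply: stays; exists n.
have [N N_leaves] := choice leaves.
have /finite_seqP[s Ns] := finite_image N finD.
have [x [Dx Sx]] := DS (\max_(k <- s) k).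
have Nx_s : N x \in s.
  have : (N @` D) (N x) by exists x.
  by rewrite Ns.
apply: (N_leaves x Dx); apply: (S_anti _ _ _ _ Sx).
exact: (@leq_bigmax_seq _ s xpredT id).
Qed.

Section HutchinsonOperator.
Context {X I : Type} {f : I -> X -> X}.
Local Notation F := (hutchinson f).

Lemma non_overlapping_index_unique (i j : I) (x y : X) :
  non_overlapping f -> f i x = f j y -> i = j.
Proof.
move=> fNO fxy; apply: contrapT => /(fNO setT) disj.
suff : (set0 : set X) (f i x) by [].
by rewrite -disj; split; [exists x | exists y].
Qed.

Lemma hutchinson_mono (A B : set X) : A `<=` B -> F A `<=` F B.
Proof.
by move=> AB _ [i _ [x Ax <-]]; exists i => //; exists x => //; apply: AB.
Qed.

Lemma iter_hutchinson_nonincreasing (A : set X) : F A `<=` A ->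
  forall m n, m <= n -> iter n F A `<=` iter m F A.
Proof.
move=> FA; apply: (@homo_leq _ _ (fun B C => C `<=` B)).
- by move=> B.
- by move=> B C D BC DB; apply: subset_trans DB BC.
- by elim=> [//|n IHn]; apply: hutchinson_mono.
Qed.

Lemma iterates_cap_fixed (A : set X) :
  non_overlapping f -> finite_fibres f -> F A `<=` A ->
  fixed_set F (iterates_cap f A).
Proof.
move=> fNO fFin FA.
have anti := iter_hutchinson_nonincreasing A FA.
apply/seteqP; split=> [_ [i _ [x Cx <-]] n _|y Cy].
  apply: (anti n n.+1) => //.
  by exists i => //; exists x => //; apply: Cx.
have [i _ [x0 _ fx0]] := Cy 1 Logic.I.
have fibre_meets n : f i @^-1` [set y] `&` iter n F A !=set0.
  have [j _ [x Ax fx]] := Cy n.+1 Logic.I.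
  exists x; split=> //=.
  by rewrite (non_overlapping_index_unique i j x0 x fNO) // fx0 fx.
have [x [fx Cx]] :=
  finite_set_meets_nonincreasing_cap _ _ _ (fFin i y) anti fibre_meets.
by exists i => //; exists x.
Qed.

Lemma fixed_sub_iterates_cap (B : set X) :
  fixed_set F B -> B `<=` iterates_cap f setT.
Proof.
move=> FB z Bz n _; suff sub : B `<=` iter n F setT by apply: sub.
elim: n {z Bz} => [//|n IHn] /=.
by rewrite -FB; apply: hutchinson_mono.
Qed.

End HutchinsonOperator.

Theorem theorem3p1 (X I : Type) (f : I -> X -> X)
  (f_non_overlapping : non_overlapping f)
  (f_finite_fibres : finite_fibres f) :
  (forall A : set X, hutchinson f A `<=` A ->
     fixed_set (hutchinson f) (iterates_cap f A)) /\
  greatest_fixed_set (hutchinson f) (iterates_cap f [set: X]) /\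
  ((exists A : set X, A !=set0 /\ fixed_set (hutchinson f) A) <->
     iterates_cap f [set: X] !=set0).
Proof.
have capT_fixed : fixed_set (hutchinson f) (iterates_cap f setT).
  exact: iterates_cap_fixed.
split; first by move=> A; apply: iterates_cap_fixed.
split; first by split=> //; apply: fixed_sub_iterates_cap.
split=> [[A [[x Ax] FA]]|capT_n0]; last by exists (iterates_cap f setT).
by exists x; apply: (fixed_sub_iterates_cap _ FA).
Qed.
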